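(* Assume that $X\in 2^\omega$ has DNC degree and $C\in 2^\omega$ is a computably enumerable set. Then either $X\oplus C\geq_T\emptyset'$ or $X$ has DNC degree relative to $C$.
   Context: $X$ has DNC degree if $X$ computes a function $g\colon\omega\to\omega$ with $g(e)\neq\varphi_e(e)$ whenever $\varphi_e(e)$ is defined (a diagonally noncomputable function). $X$ has DNC degree relative to $C$ if $X$ computes a $g$ with $g(e)\neq\varphi^C_e(e)$ whenever $\varphi^C_e(e)$ is defined. *)

(* Defs.v *)
From Stdlib Require Import Arith Lia Cantor ClassicalEpsilon.

(** Elements of 2^omega, identified with the subsets of omega. *)
Definition cantor := nat -> bool.

Definition char (A : cantor) (x : nat) : nat := if A x then 1 else 0.

Definition pairn (x y : nat) : nat := Cantor.to_nat (x, y).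
Arguments pairn : simpl never.

Notation "<< x , y >>" := (pairn x y).

Lemma of_pairn x y : Cantor.of_nat <<x, y>> = (x, y).
Proof. apply Cantor.cancel_of_to. Qed.

Lemma pairn_inj x y x' y' : <<x, y>> = <<x', y'>> -> x = x' /\ y = y'.
Proof. intros E; injection (Cantor.to_nat_inj _ _ E); auto. Qed.

Lemma le_pairn x y : y + x <= <<x, y>>.
Proof. apply Cantor.to_nat_non_decreasing. Qed.

(** Programs for the partial functions from omega to omega that are recursive in
    an oracle: Kleene's schemes, in unary form by means of the Cantor pairing.
    [Pair Fst Snd] is the identity. *)
Inductive prog : Type :=
| Zero
| Succ
| Fst
| Snd
| Oracle
| Pair (p q : prog)
| Comp (p q : prog)
| Prec (p q : prog)
| Mu (p : prog).

(** [eval A p x y]: with oracle [A], program [p] halts on input [x] with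
    output [y]. *)
Inductive eval (A : cantor) : prog -> nat -> nat -> Prop :=
| eval_Zero x : eval A Zero x 0
| eval_Succ x : eval A Succ x (S x)
| eval_Fst x y : eval A Fst <<x, y>> x
| eval_Snd x y : eval A Snd <<x, y>> y
| eval_Oracle x : eval A Oracle x (char A x)
| eval_Pair p q x y z :
    eval A p x y -> eval A q x z -> eval A (Pair p q) x <<y, z>>
| eval_Comp p q x y z :
    eval A q x y -> eval A p y z -> eval A (Comp p q) x z
| eval_Prec_0 p q x y :
    eval A p x y -> eval A (Prec p q) <<x, 0>> y
| eval_Prec_S p q x n y z :
    eval A (Prec p q) <<x, n>> y -> eval A q <<x, <<n, y>>>> z ->
    eval A (Prec p q) <<x, S n>> z
(* [v] records the nonzero values found before [n]; in particular they are all
   defined. *)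
| eval_Mu p x n (v : nat -> nat) :
    (forall m, m < n -> eval A p <<x, m>> (S (v m))) ->
    eval A p <<x, n>> 0 ->
    eval A (Mu p) x n.

Lemma eval_fun (A : cantor) p x y z : eval A p x y -> eval A p x z -> y = z.
Proof.
intros H; revert z.
induction H as [x|x|x y|x y|x|p q x y z _ IHp _ IHq|p q x y z _ IHq _ IHp
  |p q x y _ IHp|p q x n y z _ IHr _ IHq|p x n v _ IHlt _ IHn];
  intros w Hw;
  (* generalizing the input keeps [inversion] from unfolding the pairing *)
  try match type of Hw with eval _ _ << ?a, ?b >> _ =>
    remember <<a, b>> as i eqn:Ei end;
  inversion Hw; subst; auto;
  repeat match goal with
  | E : << _, _ >> = << _, _ >> |- _ => apply pairn_inj in E; destruct E
  end; subst; try discriminate; auto.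
- match goal with H1 : eval A q x _ |- _ => apply IHq in H1; subst end; auto.
- match goal with E : S _ = S _ |- _ => injection E; intros; subst end.
  match goal with H1 : eval A (Prec p q) <<x, n>> _ |- _ =>
    apply IHr in H1; subst end; auto.
- destruct (Nat.lt_trichotomy n w) as [Hnw|[->|Hwn]]; [|reflexivity|].
  + match goal with H1 : forall m, m < w -> _ |- _ =>
      specialize (IHn _ (H1 _ Hnw)); discriminate end.
  + match goal with H1 : eval A p <<x, w>> 0 |- _ =>
      specialize (IHlt _ Hwn _ H1); discriminate end.
Qed.

(** One of the infinitely many indices of [p]; see [decode]. *)
Fixpoint encode (p : prog) : nat :=
  match p with
  | Zero => <<0, 0>>
  | Succ => <<1, 0>>
  | Fst => <<2, 0>>
  | Snd => <<3, 0>>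
  | Oracle => <<4, 0>>
  | Pair p q => <<5, <<encode p, encode q>>>>
  | Comp p q => <<6, <<encode p, encode q>>>>
  | Prec p q => <<7, <<encode p, encode q>>>>
  | Mu p => <<8, encode p>>
  end.

(** Every number is an index. The fuel [S e] suffices for [e], because both
    components of a Cantor pair are bounded by the pair, and the second one
    strictly so when the tag is nonzero. *)
Fixpoint decode_fuel (k e : nat) : prog :=
  match k with
  | 0 => Zero
  | S k =>
    let (t, r) := Cantor.of_nat e in
    let (a, b) := Cantor.of_nat r in
    match t with
    | 0 => Zero
    | 1 => Succ
    | 2 => Fst
    | 3 => Snd
    | 4 => Oracle
    | 5 => Pair (decode_fuel k a) (decode_fuel k b)
    | 6 => Comp (decode_fuel k a) (decode_fuel k b)
    | 7 => Prec (decode_fuel k a) (decode_fuel k b)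
    | _ => Mu (decode_fuel k r)
    end
  end.

Definition decode (e : nat) : prog := decode_fuel (S e) e.

Lemma decode_fuelK p k : encode p < k -> decode_fuel k (encode p) = p.
Proof.
revert k; induction p; intros [|k] Hk; try lia; cbn [encode] in Hk;
  cbn [encode decode_fuel]; rewrite !of_pairn;
  try (destruct (Cantor.of_nat _); reflexivity).
1-3: assert (H1 := le_pairn (encode p1) (encode p2));
  match type of Hk with << ?t , ?r >> < _ =>
    assert (H2 := le_pairn t r) end;
  rewrite IHp1, IHp2 by lia; reflexivity.
assert (H2 := le_pairn 8 (encode p)).
destruct (Cantor.of_nat (encode p)); rewrite IHp by lia; reflexivity.
Qed.

Lemma decodeK p : decode (encode p) = p.
Proof. apply decode_fuelK; lia. Qed.

(** [phi A e x y]: phi_e^A(x) is defined and equal to [y]. *)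
Definition phi (A : cantor) (e x y : nat) : Prop := eval A (decode e) x y.

(** The empty set; phi_e without an oracle is [phi empty e]. *)
Definition empty : cantor := fun _ => false.

Definition computes (X : cantor) (g : nat -> nat) : Prop :=
  exists e, forall x, phi X e x (g x).

(** [A] is Turing reducible to [B]. *)
Definition turing_le (A B : cantor) : Prop := computes B (char A).

Definition join (A B : cantor) : cantor :=
  fun n => if Nat.even n then A (Nat.div2 n) else B (Nat.div2 n).

(** The halting set { e | phi_e(e) is defined }. *)
Definition jump_empty : cantor :=
  fun e => if excluded_middle_informative (exists y, phi empty e e y)
           then true else false.

(** [C] is the domain of some partial computable function. *)
Definition comp_enum (C : cantor) : Prop :=
  exists e, forall x, C x = true <-> exists y, phi empty e x y.

Definition dnc_rel (C : cantor) (g : nat -> nat) : Prop :=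
  forall e y, phi C e e y -> g e <> y.

Definition has_DNC_degree_rel (C X : cantor) : Prop :=
  exists g, computes X g /\ dnc_rel C g.

Definition has_DNC_degree (X : cantor) : Prop := has_DNC_degree_rel empty X.

(* Main.v *)
From Stdlib Require Import Arith Lia List Cantor Classical ClassicalEpsilon.
Require Import Defs.
Import ListNotations.

(** Let [g], computed by [X], be diagonally noncomputable, and let [C_s] be the
    elements enumerated into [C] by stage [s]. For each [n] and [e] consider the
    program, with index [h (e, n)], that waits for a stage [s] at which [n]
    enters the halting set and then returns the output of the [e]-th program on
    [e] after [s] steps with oracle [C_s]; thus [g (h (e, n))] differs from that
    output. If for some [n] the function sending [e] to [g (h (e, n))] is
    diagonally noncomputable relative to [C], we are done. Otherwise, for each
    [n], [join X C] finds [e] and a stage [t] by which the [e]-th program halts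
    on [e] with output [g (h (e, n))], all its oracle queries being answered
    alike by [C] and [C_t]. The computation then persists with the oracles
    [C_s], [s >= t], so [n] cannot enter the halting set after [t]. *)

(** * Projections of the Cantor pairing *)

Definition pfst (z : nat) : nat := fst (Cantor.of_nat z).
Definition psnd (z : nat) : nat := snd (Cantor.of_nat z).

Lemma pfst_pairn x y : pfst <<x, y>> = x.
Proof. unfold pfst; now rewrite of_pairn. Qed.

Lemma psnd_pairn x y : psnd <<x, y>> = y.
Proof. unfold psnd; now rewrite of_pairn. Qed.

Lemma pairn_eta z : <<pfst z, psnd z>> = z.
Proof.
unfold pairn, pfst, psnd; rewrite <- surjective_pairing; apply Cantor.cancel_to_of.
Qed.

#[local] Hint Rewrite pfst_pairn psnd_pairn : pairn.

(** * Total functions computable from an oracle *)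

Definition total_in (A : cantor) (f : nat -> nat) : Prop :=
  exists p, forall x, eval A p x (f x).

Lemma computes_total_in A f : computes A f <-> total_in A f.
Proof.
split; [intros [e He]; now exists (decode e)|intros [p Hp]; exists (encode p)].
intros x; unfold phi; rewrite decodeK; apply Hp.
Qed.

Section Closure.
Variable A : cantor.

Lemma total_ext f g : (forall x, f x = g x) -> total_in A f -> total_in A g.
Proof. intros E [p Hp]; exists p; intros x; rewrite <- E; apply Hp. Qed.

Lemma total_comp g f :
  total_in A g -> total_in A f -> total_in A (fun x => g (f x)).
Proof. intros [q Hq] [p Hp]; exists (Comp q p); intros x; econstructor; eauto. Qed.

Lemma total_pair f g :
  total_in A f -> total_in A g -> total_in A (fun x => <<f x, g x>>).
Proof. intros [q Hq] [p Hp]; exists (Pair q p); intros x; now constructor. Qed.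

Lemma total_pfst f : total_in A f -> total_in A (fun x => pfst (f x)).
Proof.
apply total_comp; exists Fst; intros x.
rewrite <- (pairn_eta x) at 1; constructor.
Qed.

Lemma total_psnd f : total_in A f -> total_in A (fun x => psnd (f x)).
Proof.
apply total_comp; exists Snd; intros x.
rewrite <- (pairn_eta x) at 1; constructor.
Qed.

Lemma eval_Pair_Fst_Snd x : eval A (Pair Fst Snd) x x.
Proof. rewrite <- (pairn_eta x); repeat constructor. Qed.

Lemma total_id : total_in A (fun x => x).
Proof. exists (Pair Fst Snd); exact eval_Pair_Fst_Snd. Qed.

Lemma total_S f : total_in A f -> total_in A (fun x => S (f x)).
Proof. apply total_comp; exists Succ; constructor. Qed.

Lemma total_const k : total_in A (fun _ => k).
Proof. induction k; [exists Zero; constructor|now apply total_S]. Qed.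

Lemma total_char f : total_in A f -> total_in A (fun x => char A (f x)).
Proof. apply (total_comp (char A)); exists Oracle; constructor. Qed.

Lemma total_comp2 (g : nat -> nat -> nat) f1 f2 :
  total_in A (fun z => g (pfst z) (psnd z)) -> total_in A f1 -> total_in A f2 ->
  total_in A (fun x => g (f1 x) (f2 x)).
Proof.
intros Hg H1 H2; generalize (total_comp _ _ Hg (total_pair _ _ H1 H2)).
now apply total_ext; intros x; autorewrite with pairn.
Qed.

Lemma total_nat_rec (g : nat -> nat -> nat -> nat) f k :
  total_in A f -> total_in A k ->
  total_in A (fun z => g (pfst z) (pfst (psnd z)) (psnd (psnd z))) ->
  total_in A (fun x => nat_rec (fun _ => nat) (f x) (g x) (k x)).
Proof.
intros [p Hp] [r Hr] [q Hq]; exists (Comp (Prec p q) (Pair (Pair Fst Snd) r)).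
intros x; econstructor.
  constructor; [apply eval_Pair_Fst_Snd|apply Hr].
induction (k x) as [|n IHn]; [now constructor|].
econstructor; [exact IHn|].
specialize (Hq <<x, <<n, nat_rec (fun _ => nat) (f x) (g x) n>>>>).
autorewrite with pairn in Hq; exact Hq.
Qed.

Lemma total_pred f : total_in A f -> total_in A (fun x => pred (f x)).
Proof.
intros Hf; apply (total_ext (fun x => nat_rec (fun _ => nat) 0 (fun n _ => n) (f x))).
  now intros x; destruct (f x).
apply (total_nat_rec (fun _ n _ => n)); auto using total_const.
apply total_pfst, total_psnd, total_id.
Qed.

(** [nth] into an explicit list serves as case distinction; this lemma and the next peel off the
    list entry by entry. *)
Lemma total_nth_nil t d : total_in A d -> total_in A (fun x => nth (t x) [] (d x)).
Proof. now apply total_ext; intros x; destruct (t x). Qed.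

Lemma total_nth_cons t b l d :
  total_in A t -> total_in A b ->
  total_in A (fun x => nth (pred (t x)) (l x) (d x)) ->
  total_in A (fun x => nth (t x) (b x :: l x) (d x)).
Proof.
intros Ht Hb Hl.
set (r x := nth (pred (t x)) (l x) (d x)).
(* The step function ignores its recursive value, so this recursion merely tests whether [t x] is
   zero. *)
apply (total_ext (fun x => nat_rec (fun _ => nat) (b x) (fun _ _ => r x) (t x))).
  now intros x; unfold r; destruct (t x).
apply (total_nat_rec (fun x _ _ => r x)); auto.
apply total_comp; [exact Hl|apply total_pfst, total_id].
Qed.

Lemma total_sub f g :
  total_in A f -> total_in A g -> total_in A (fun x => f x - g x).
Proof.
intros Hf Hg.
apply (total_ext (fun x => nat_rec (fun _ => nat) (f x) (fun _ y => pred y) (g x))).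
  intros x; generalize (f x) as a; induction (g x) as [|n IHn]; intros a; simpl.
    lia.
  rewrite IHn; lia.
apply (total_nat_rec (fun _ _ y => pred y)); auto.
apply total_pred, total_psnd, total_psnd, total_id.
Qed.

Lemma total_add f g :
  total_in A f -> total_in A g -> total_in A (fun x => f x + g x).
Proof.
intros Hf Hg.
apply (total_ext (fun x => nat_rec (fun _ => nat) (f x) (fun _ y => S y) (g x))).
  intros x; induction (g x) as [|n IHn]; simpl; [lia|rewrite IHn; lia].
apply (total_nat_rec (fun _ _ y => S y)); auto.
apply total_S, total_psnd, total_psnd, total_id.
Qed.

(** Strong induction descends from the given zero [m] to the least one, which is where [Mu]
    stops. *)
Lemma eval_Mu_total p f x m :
  (forall z, eval A p z (f z)) -> f <<x, m>> = 0 ->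
  exists n, eval A (Mu p) x n /\ f <<x, n>> = 0.
Proof.
intros Hp; induction m as [m IHm] using lt_wf_ind; intros Hm.
destruct (classic (exists k, k < m /\ f <<x, k>> = 0)) as [[k [Hk Fk]]|Hmin].
  exact (IHm k Hk Fk).
exists m; split; [|exact Hm].
apply eval_Mu with (v := fun k => pred (f <<x, k>>)).
- intros k Hk; specialize (Hp <<x, k>>).
  destruct (f <<x, k>>) eqn:E; [exfalso; eauto|exact Hp].
- rewrite <- Hm; apply Hp.
Qed.

Lemma total_search f :
  total_in A f -> (forall x, exists m, f <<x, m>> = 0) ->
  exists s, total_in A s /\ forall x, f <<x, s x>> = 0.
Proof.
intros [p Hp] Hf.
assert (H : forall x, exists n, eval A (Mu p) x n /\ f <<x, n>> = 0).
  intros x; destruct (Hf x) as [m Hm]; now apply eval_Mu_total with m.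
exists (fun x => proj1_sig (constructive_indefinite_description _ (H x))).
split; [exists (Mu p)|]; intros x; destruct constructive_indefinite_description;
  simpl; tauto.
Qed.

End Closure.

(** Goals about functions not built from the listed operations are left to the user. *)
Ltac total :=
  cbv beta zeta;
  lazymatch goal with
  | |- total_in _ (fun x => x) => apply total_id
  | |- total_in _ pfst => apply (total_pfst _ (fun x => x)), total_id
  | |- total_in _ psnd => apply (total_psnd _ (fun x => x)), total_id
  | |- total_in _ (fun x => S (@?f x)) => apply (total_S _ f); total
  | |- total_in _ (fun x => pred (@?f x)) => apply (total_pred _ f); total
  | |- total_in _ (fun x => pfst (@?f x)) => apply (total_pfst _ f); total
  | |- total_in _ (fun x => psnd (@?f x)) => apply (total_psnd _ f); total
  | |- total_in _ (fun x => <<@?f x, @?g x>>) => apply (total_pair _ f g); total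
  | |- total_in _ (fun x => @?f x - @?g x) => apply (total_sub _ f g); total
  | |- total_in _ (fun x => @?f x + @?g x) => apply (total_add _ f g); total
  | |- total_in ?A (fun x => char ?A (@?f x)) => apply (total_char _ f); total
  | |- total_in _ (fun x => nth (@?t x) [] (@?d x)) =>
      apply (total_nth_nil _ t d); total
  | |- total_in _ (fun x => nth (@?t x) (@?b x :: @?l x) (@?d x)) =>
      apply (total_nth_cons _ t b l d); total
  | |- total_in _ (fun x => ?k) => first [apply total_const | idtac]
  | |- _ => idtac
  end.

(** * Oracle substitution and joins *)

Fixpoint relativize (q p : prog) : prog :=
  match p with
  | Oracle => q
  | Pair p1 p2 => Pair (relativize q p1) (relativize q p2)
  | Comp p1 p2 => Comp (relativize q p1) (relativize q p2)
  | Prec p1 p2 => Prec (relativize q p1) (relativize q p2)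
  | Mu p1 => Mu (relativize q p1)
  | _ => p
  end.

Lemma total_relativize A B f :
  total_in B (char A) -> total_in A f -> total_in B f.
Proof.
intros [q Hq] [p Hp]; exists (relativize q p); intros x.
specialize (Hp x); induction Hp; simpl; try econstructor; eauto.
Qed.

(** The double is written [x + x] because [total] handles sums. *)
Lemma join_l A B x : char (join A B) (x + x) = char A x.
Proof.
unfold char, join; replace (x + x) with (2 * x) by lia.
now rewrite Nat.even_even, Nat.div2_double.
Qed.

Lemma join_r A B x : char (join A B) (S (x + x)) = char B x.
Proof.
unfold char, join; replace (S (x + x)) with (2 * x + 1) by lia.
rewrite Nat.even_odd, Nat.add_1_r, Nat.div2_succ_double; reflexivity.
Qed.

Lemma total_join_l A B f : total_in A f -> total_in (join A B) f.
Proof.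
apply total_relativize; apply (total_ext _ _ _ (join_l A B)); total.
Qed.

Lemma total_join_r A B f : total_in B f -> total_in (join A B) f.
Proof.
apply total_relativize; apply (total_ext _ _ _ (join_r A B)); total.
Qed.

(** * Numerals and the s-m-n theorem *)

Fixpoint numeral (k : nat) : prog :=
  match k with 0 => Zero | S k => Comp Succ (numeral k) end.

Lemma eval_numeral A k x : eval A (numeral k) x k.
Proof. induction k; simpl; econstructor; eauto; constructor. Qed.

(** An s-m-n theorem: [Comp p (numeral z)] ignores its input and runs [p] on [z]. The tag 6 is that
    of [Comp] in [encode]. *)
Lemma total_encode_numeral A p :
  total_in A (fun z => encode (Comp p (numeral z))).
Proof.
apply (total_pair _ (fun _ => 6) (fun z => <<encode p, encode (numeral z)>>));
  [total|].
apply (total_pair _ (fun _ => encode p) (fun z => encode (numeral z))); [total|].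
apply (total_ext _ (fun z => nat_rec (fun _ => nat) (encode Zero)
  (fun _ y => <<6, <<encode Succ, y>>>>) z)).
  intros z; induction z as [|z IHz]; [reflexivity|].
  cbn [nat_rec nat_rect numeral]; now rewrite IHz.
apply (total_nat_rec _ (fun _ _ y => <<6, <<encode Succ, y>>>>)); total.
Qed.

(** * A universal abstract machine *)

Lemma decode_fuel_irrel k k' e :
  e < k -> e < k' -> decode_fuel k e = decode_fuel k' e.
Proof.
revert k' e; induction k as [|k IHk]; intros [|k'] e; try lia; intros Hk Hk'.
cbn [decode_fuel].
assert (E := pairn_eta e); unfold pfst, psnd in E.
destruct (Cantor.of_nat e) as [t r]; cbn in E.
assert (F := pairn_eta r); unfold pfst, psnd in F.
destruct (Cantor.of_nat r) as [a b]; cbn in F.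
assert (H1 := le_pairn t r); assert (H2 := le_pairn a b).
do 8 (destruct t as [|t]; [try reflexivity; f_equal; apply IHk; lia|]).
f_equal; apply IHk; lia.
Qed.

Lemma decode_pairn t r :
  decode <<t, r>> =
  match t with
  | 0 => Zero
  | 1 => Succ
  | 2 => Fst
  | 3 => Snd
  | 4 => Oracle
  | 5 => Pair (decode (pfst r)) (decode (psnd r))
  | 6 => Comp (decode (pfst r)) (decode (psnd r))
  | 7 => Prec (decode (pfst r)) (decode (psnd r))
  | _ => Mu (decode r)
  end.
Proof.
unfold decode at 1; cbn [decode_fuel]; rewrite of_pairn.
assert (F := pairn_eta r); unfold pfst, psnd in *.
destruct (Cantor.of_nat r) as [a b]; cbn [fst snd] in *.
assert (H1 := le_pairn t r); assert (H2 := le_pairn a b).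
do 8 (destruct t as [|t];
  [try reflexivity; f_equal; apply decode_fuel_irrel; lia|]).
f_equal; apply decode_fuel_irrel; lia.
Qed.

(** A configuration is [<<v, K>>], where [v] is the current value and [K] is a
    stack of tasks: [0] if empty, [push i d K] for a task of kind [i] with data
    [d] on top of [K]. A task of kind [0] replaces the value [v] by the result of
    the program with index [d] on input [v]; the other kinds of task resume a
    suspended [Pair] (1 and 2), [Prec] (3) or [Mu] (otherwise). The machine has
    halted when the stack is empty, and loops on oracle answers other than [0]
    and [1]. Case distinctions are written with [nth]. *)
Definition push (i d K : nat) : nat := S <<<<i, d>>, K>>.

(** The list is indexed by the tags of [decode], with [Mu] as default. At a positive counter, [Prec]
    first computes the value at the predecessor [n]; [Mu] starts with candidate 0. *)
Definition step_eval (o : nat -> nat) (v e K : nat) : nat :=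
  let r := psnd e in
  let a := pfst r in
  let b := psnd r in
  let x := pfst v in
  let n := pred (psnd v) in
  nth (pfst e)
    [ <<0, K>>;
      <<S v, K>>;
      <<pfst v, K>>;
      <<psnd v, K>>;
      nth (o v) [<<0, K>>; <<1, K>>] <<v, push 0 e K>>;
      <<v, push 0 a (push 1 <<b, v>> K)>>;
      <<v, push 0 b (push 0 a K)>>;
      nth (psnd v) [<<x, push 0 a K>>]
        <<<<x, n>>, push 0 e (push 3 <<b, <<x, n>>>> K)>> ]
    <<<<v, 0>>, push 0 r (push 4 <<r, <<v, 0>>>> K)>>.

Definition step (o : nat -> nat) (c : nat) : nat :=
  let v := pfst c in
  let s := psnd c in
  let d := psnd (pfst (pred s)) in
  let K := psnd (pred s) in
  let x := pfst (psnd d) in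
  let n := psnd (psnd d) in
  nth s [c]
    (nth (pfst (pfst (pred s)))
      [ step_eval o v d K;
        <<psnd d, push 0 (pfst d) (push 2 v K)>>;
        <<<<d, v>>, K>>;
        <<<<x, <<n, v>>>>, push 0 (pfst d) K>> ]
      (nth v [<<n, K>>]
        <<<<x, S n>>, push 0 (pfst d) (push 4 <<pfst d, <<x, S n>>>> K)>>)).

Definition run (o : nat -> nat) (k c : nat) : nat := Nat.iter k (step o) c.

Definition init (e x : nat) : nat := <<x, push 0 e 0>>.

Lemma run_S o k c : run o (S k) c = run o k (step o c).
Proof. apply Nat.iter_succ_r. Qed.

Lemma run_add o j k c : run o (j + k) c = run o k (run o j c).
Proof. unfold run; rewrite Nat.add_comm; apply Nat.iter_add. Qed.

Lemma step_halted o c : psnd c = 0 -> step o c = c.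
Proof. intros H; unfold step; now rewrite H. Qed.

Lemma run_halted o k j c :
  psnd (run o k c) = 0 -> k <= j -> run o j c = run o k c.
Proof.
intros H Hkj; replace j with (k + (j - k)) by lia; rewrite run_add.
generalize (j - k) as i; induction i as [|i IHi]; [reflexivity|].
now rewrite run_S, step_halted.
Qed.

Lemma nth_S_single (n b d : nat) : nth (S n) [b] d = d.
Proof. now destruct n. Qed.

#[local] Hint Rewrite nth_S_single : pairn.

Ltac step_tac :=
  unfold step, push; autorewrite with pairn; cbn [pred]; autorewrite with pairn;
  cbn [nth]; autorewrite with pairn.

Lemma step_push0 o v e K : step o <<v, push 0 e K>> = step_eval o v e K.
Proof. now step_tac. Qed.

Lemma step_push1 o v b x K :
  step o <<v, push 1 <<b, x>> K>> = <<x, push 0 b (push 2 v K)>>.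
Proof. now step_tac. Qed.

Lemma step_push2 o v y K : step o <<v, push 2 y K>> = <<<<y, v>>, K>>.
Proof. now step_tac. Qed.

Lemma step_push3 o v b x n K :
  step o <<v, push 3 <<b, <<x, n>>>> K>> = <<<<x, <<n, v>>>>, push 0 b K>>.
Proof. now step_tac. Qed.

Lemma step_push4 o v r x n K :
  step o <<v, push 4 <<r, <<x, n>>>> K>> =
  nth v [<<n, K>>] <<<<x, S n>>, push 0 r (push 4 <<r, <<x, S n>>>> K)>>.
Proof. now step_tac. Qed.

(** The oracle depends on a parameter [w x], since later it varies with the stage. *)
Lemma total_step A (o : nat -> nat -> nat) w c :
  total_in A (fun z => o (pfst z) (psnd z)) -> total_in A w -> total_in A c ->
  total_in A (fun x => step (o (w x)) (c x)).
Proof.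
intros Ho Hw Hc.
apply (total_comp2 A (fun w c => step (o w) c)); auto.
unfold step, step_eval, push; total; apply (total_comp2 A o); auto; total.
Qed.

Lemma total_run A (o : nat -> nat -> nat) w k c :
  total_in A (fun z => o (pfst z) (psnd z)) ->
  total_in A w -> total_in A k -> total_in A c ->
  total_in A (fun x => run (o (w x)) (k x) (c x)).
Proof.
intros Ho Hw Hk Hc.
apply (total_ext _ (fun x => nat_rec (fun _ => nat) (c x) (fun _ => step (o (w x))) (k x))).
  intros x; induction (k x) as [|n IHn]; simpl; [reflexivity|now rewrite IHn].
apply (total_nat_rec _ (fun x _ => step (o (w x)))); auto.
apply total_step; [exact Ho|apply (total_comp _ w)|]; auto; total.
Qed.

(* Along a halting run no oracle answer is out of range, so the runs with [o]
   and [o'] coincide. *)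
Lemma run_oracle_mono o o' k c :
  (forall q, o q < 2 -> o' q = o q) ->
  psnd (run o k c) = 0 -> run o' k c = run o k c.
Proof.
intros Ho; revert c; induction k as [|k IHk]; intros c; [reflexivity|].
rewrite !run_S; intros Hh.
enough (E : step o' c = step o c) by (rewrite E; now apply IHk).
(* The steps can differ only at a query that [o] answers out of range; there [o] leaves [c] fixed
   with a nonempty stack, so its run never halts. *)
assert (Hs : step o' c = step o c \/ step o c = c /\ psnd c <> 0).
  unfold step; destruct (psnd c) as [|s] eqn:Es; [now left|cbn [pred]].
  rewrite !nth_S_single.
  destruct (pfst (pfst s)) as [|i] eqn:Ei; [cbn [nth]|now left].
  unfold step_eval.
  destruct (pfst (psnd (pfst s))) as [|[|[|[|[|t]]]]] eqn:Et; try now left.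
  cbn [nth].
  destruct (Nat.lt_ge_cases (o (pfst c)) 2) as [Hlt|Hge].
    left; now rewrite Ho.
  right; split; [|lia].
  transitivity <<pfst c, psnd c>>; [|apply pairn_eta].
  destruct (o (pfst c)) as [|[|[|u]]]; try lia; f_equal; rewrite Es; unfold push;
  f_equal; rewrite <- Ei, !pairn_eta; reflexivity.
destruct Hs as [E|[E Hc]]; [exact E|exfalso].
rewrite E in Hh; apply Hc; clear -E Hh.
induction k as [|k IHk]; [exact Hh|rewrite run_S, E in Hh; auto].
Qed.

(** A halting run must finish the top task before touching [K]. The bound [j < k] lets strong
    induction on [k] treat the tasks pushed one after another. *)
Lemma run_sound A o k e v K :
  (forall q, o q = char A q) ->
  psnd (run o k <<v, push 0 e K>>) = 0 ->
  exists y j, j < k /\ eval A (decode e) v y /\ psnd (run o j <<y, K>>) = 0.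
Proof.
intros Ho; revert e v K; induction k as [k IHk] using lt_wf_ind; intros e v K Hk.
destruct k as [|k]; [now cbn in Hk; rewrite psnd_pairn in Hk|].
rewrite <- (pairn_eta e) in Hk |- *; revert Hk.
generalize (pfst e) as t, (psnd e) as r; clear e; intros t r Hk.
rewrite decode_pairn; rewrite run_S, step_push0 in Hk; unfold step_eval in Hk.
autorewrite with pairn in Hk.
assert (Ev := pairn_eta v).
destruct t as [|[|[|[|[|[|[|[|t]]]]]]]]; cbn [nth] in Hk.
- exists 0, k; repeat split; [lia|constructor|exact Hk].
- exists (S v), k; repeat split; [lia|constructor|exact Hk].
- exists (pfst v), k; repeat split; [lia| |exact Hk].
  rewrite <- Ev at 1; constructor.
- exists (psnd v), k; repeat split; [lia| |exact Hk].
  rewrite <- Ev at 1; constructor.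
- exists (char A v), k; repeat split; [lia|constructor|].
  rewrite Ho in Hk; unfold char in *; now destruct (A v).
- apply IHk in Hk; [|lia]; destruct Hk as (y & j & Hj & Hy & Hk).
  destruct j as [|j]; [now cbn in Hk; rewrite psnd_pairn in Hk|].
  rewrite run_S, step_push1 in Hk.
  apply IHk in Hk; [|lia]; destruct Hk as (z & i & Hi & Hz & Hk).
  destruct i as [|i]; [now cbn in Hk; rewrite psnd_pairn in Hk|].
  rewrite run_S, step_push2 in Hk.
  exists <<y, z>>, i; repeat split; [lia|now constructor|exact Hk].
- apply IHk in Hk; [|lia]; destruct Hk as (y & j & Hj & Hy & Hk).
  apply IHk in Hk; [|lia]; destruct Hk as (z & i & Hi & Hz & Hk).
  exists z, i; repeat split; [lia|econstructor; eauto|exact Hk].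
- destruct (psnd v) as [|n]; cbn [nth pred] in Hk; rewrite <- Ev.
  + apply IHk in Hk; [|lia]; destruct Hk as (y & j & Hj & Hy & Hk).
    exists y, j; repeat split; [lia|now constructor|exact Hk].
  + assert (Hk' : psnd (run o k <<<<pfst v, n>>,
      push 0 <<7, r>> (push 3 <<psnd r, <<pfst v, n>>>> K)>>) = 0).
      destruct n; exact Hk.
    clear Hk; apply IHk in Hk'; [|lia]; destruct Hk' as (y & j & Hj & Hy & Hk).
    rewrite decode_pairn in Hy.
    destruct j as [|j]; [now cbn in Hk; rewrite psnd_pairn in Hk|].
    rewrite run_S, step_push3 in Hk.
    apply IHk in Hk; [|lia]; destruct Hk as (z & i & Hi & Hz & Hk).
    exists z, i; repeat split; [lia|econstructor; eauto|exact Hk].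
(* [Mu] about to test candidate [n] with [j] steps left; [w] records the predecessors of the values
   at the rejected candidates. *)
- enough (Loop : forall j n w, j <= k ->
      (forall m, m < n -> eval A (decode r) <<v, m>> (S (w m))) ->
      psnd (run o j <<<<v, n>>, push 0 r (push 4 <<r, <<v, n>>>> K)>>) = 0 ->
      exists y i, i < j /\ eval A (Mu (decode r)) v y /\
        psnd (run o i <<y, K>>) = 0).
  { destruct (Loop k 0 (fun m => m)) as (y & i & Hi & Hy & Hh); [lia|lia| |].
      destruct t; exact Hk.
    exists y, i; repeat split; [lia|exact Hy|exact Hh]. }
  clear Hk; induction j as [j IHj] using lt_wf_ind; intros n w Hj Hw Hk.
  apply IHk in Hk; [|lia]; destruct Hk as (y & i & Hi & Hy & Hk).
  destruct i as [|i]; [now cbn in Hk; rewrite psnd_pairn in Hk|].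
  rewrite run_S, step_push4 in Hk; destruct y as [|y]; cbn [nth] in Hk.
  + exists n, i; repeat split; [lia|econstructor; eauto|exact Hk].
  + assert (Hk' : psnd (run o i
      <<<<v, S n>>, push 0 r (push 4 <<r, <<v, S n>>>> K)>>) = 0).
      destruct y; exact Hk.
    apply (IHj i) with (w := fun m => if m =? n then y else w m) in Hk'.
    * destruct Hk' as (z & l & Hl & Hz & Hh).
      exists z, l; repeat split; [lia|exact Hz|exact Hh].
    * lia.
    * lia.
    * intros m Hm; destruct (Nat.eqb_spec m n) as [->|Hne]; [exact Hy|].
      apply Hw; lia.
Qed.

(* [reaches o e v y]: with the oracles [o t], [t] large, task [e] turns the
   value [v] into [y], in a number of steps independent of [t]. *)
Definition reaches (o : nat -> nat -> nat) (e v y : nat) : Prop :=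
  exists k t0, forall t K, t0 <= t -> run (o t) k <<v, push 0 e K>> = <<y, K>>.

(** The use principle: a computation makes finitely many queries, and beyond the largest of their
    thresholds [o t] answers them all as [A] does. *)
Lemma run_complete A o e v y :
  (forall q, exists t0, forall t, t0 <= t -> o t q = char A q) ->
  eval A (decode e) v y -> reaches o e v y.
Proof.
intros Ho H; remember (decode e) as p eqn:Ep; revert e Ep.
induction H as [x|x|x y|x y|x|p q x y z _ IHp _ IHq|p q x y z _ IHq _ IHp
  |p q x y _ IHp|p q x n y z _ IHr _ IHq|p x n v _ IHlt _ IHn]; intros e Ep;
  rewrite <- (pairn_eta e) in Ep |- *; revert Ep;
  generalize (pfst e) as t, (psnd e) as r; clear e; intros t r Ep; rewrite decode_pairn in Ep;
  destruct t as [|[|[|[|[|[|[|[|t]]]]]]]]; try discriminate Ep;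
  try injection Ep as Ep1 Ep2; try injection Ep as Ep.
1-4: exists 1, 0; intros s K _; rewrite run_S, step_push0;
  unfold step_eval; now autorewrite with pairn.
- destruct (Ho x) as [t0 Ht0]; exists 1, t0; intros s K Hs.
  rewrite run_S, step_push0; unfold step_eval; autorewrite with pairn; cbn [nth].
  rewrite Ht0 by exact Hs; unfold char; now destruct (A x).
- destruct (IHp _ Ep1) as (k1 & t1 & H1); destruct (IHq _ Ep2) as (k2 & t2 & H2).
  exists (S (k1 + S (k2 + 1))), (max t1 t2); intros s K Hs.
  rewrite run_S, step_push0; unfold step_eval; autorewrite with pairn; cbn [nth].
  rewrite run_add, H1, run_S, step_push1, run_add, H2, run_S, step_push2 by lia.
  reflexivity.
- destruct (IHp _ Ep1) as (k1 & t1 & H1); destruct (IHq _ Ep2) as (k2 & t2 & H2).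
  exists (S (k2 + k1)), (max t1 t2); intros s K Hs.
  rewrite run_S, step_push0; unfold step_eval; autorewrite with pairn; cbn [nth].
  rewrite run_add, H2, H1 by lia; reflexivity.
- destruct (IHp _ Ep1) as (k1 & t1 & H1).
  exists (S k1), t1; intros s K Hs.
  rewrite run_S, step_push0; unfold step_eval; autorewrite with pairn; cbn [nth].
  rewrite H1 by lia; reflexivity.
- destruct (IHr <<7, r>>) as (k1 & t1 & H1).
    rewrite decode_pairn; congruence.
  destruct (IHq _ Ep2) as (k2 & t2 & H2).
  exists (S (k1 + S k2)), (max t1 t2); intros s K Hs.
  rewrite run_S, step_push0; unfold step_eval; autorewrite with pairn.
  cbn [nth pred].
  rewrite run_add, H1, run_S, step_push3, H2 by lia; reflexivity.
(* Here [i] counts the candidates still to be rejected before the least zero [n]. *)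
- assert (Loop : forall i, i <= n -> exists k t0, forall s K, t0 <= s ->
    run (o s) k <<<<x, n - i>>, push 0 r (push 4 <<r, <<x, n - i>>>> K)>> =
    <<n, K>>).
  { induction i as [|i IHi]; intros Hi.
    - rewrite Nat.sub_0_r; destruct (IHn _ Ep) as (k & t0 & H0).
      exists (k + 1), t0; intros s K Hs.
      rewrite run_add, H0, run_S, step_push4 by exact Hs; reflexivity.
    - destruct IHi as (k1 & t1 & H1); [lia|].
      destruct (IHlt (n - S i) ltac:(lia) _ Ep) as (k2 & t2 & H2).
      exists (k2 + S k1), (max t1 t2); intros s K Hs.
      rewrite run_add, H2, run_S, step_push4 by lia; cbn [nth].
      replace (S (n - S i)) with (n - i) by lia.
      rewrite <- (H1 s K) by lia; now destruct (v (n - S i)). }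
  destruct (Loop n (le_n n)) as (k & t0 & H0); rewrite Nat.sub_diag in H0.
  exists (S k), t0; intros s K Hs.
  rewrite run_S, step_push0; unfold step_eval; autorewrite with pairn; cbn [nth].
  rewrite <- (H0 s K) by exact Hs; now destruct t.
Qed.

Lemma run_init_sound A o e x k :
  (forall q, o q = char A q) -> psnd (run o k (init e x)) = 0 ->
  exists y, phi A e x y.
Proof.
intros Ho Hk; destruct (run_sound A o k e x 0 Ho Hk) as (y & _ & _ & Hy & _).
now exists y.
Qed.

Lemma run_init_complete A o e x y :
  (forall q, exists t0, forall t, t0 <= t -> o t q = char A q) ->
  phi A e x y ->
  exists t, run (o t) t (init e x) = <<y, 0>>.
Proof.
intros Ho Hy; destruct (run_complete A o e x y Ho Hy) as (k & t0 & H).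
(* One number serves as oracle stage and as step count, because extra steps do not change a halted
   configuration. *)
exists (max t0 k).
assert (E : run (o (max t0 k)) k (init e x) = <<y, 0>>) by (apply H; lia).
rewrite <- E; apply run_halted; [rewrite E; apply psnd_pairn|lia].
Qed.

(** * Stages of a computably enumerable set *)

Definition no_oracle (q : nat) : nat := 0.

(* [domain_at c x s = 0] if and only if program [c] halts on [x] within [s]
   steps. *)
Definition domain_at (c x s : nat) : nat := psnd (run no_oracle s (init c x)).

Lemma domain_at_sound c x s : domain_at c x s = 0 -> exists y, phi empty c x y.
Proof. now apply run_init_sound. Qed.

Lemma domain_at_complete c x y : phi empty c x y -> exists s, domain_at c x s = 0.
Proof.
intros Hy; destruct (run_init_complete empty (fun _ => no_oracle) c x y)
  as [s Hs]; [now exists 0|exact Hy|].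
exists s; unfold domain_at; rewrite Hs; apply psnd_pairn.
Qed.

Lemma domain_at_mono c x s t : domain_at c x s = 0 -> s <= t -> domain_at c x t = 0.
Proof. intros H Hst; unfold domain_at; now rewrite run_halted with (k := s). Qed.

Lemma total_domain_at A c x s :
  total_in A c -> total_in A x -> total_in A s ->
  total_in A (fun z => domain_at (c z) (x z) (s z)).
Proof.
intros Hc Hx Hs; unfold domain_at; apply total_psnd.
apply (total_run A (fun _ => no_oracle) (fun _ => 0)); auto;
  unfold no_oracle, init, push; total; assumption.
Qed.

Definition stage (c s q : nat) : nat := nth (domain_at c q s) [1] 0.

(* Agrees with [C] where [C] and its [t]-th stage agree, and is out of range
   elsewhere. *)
Definition settled (C : cantor) (c t q : nat) : nat :=
  nth (char C q) [0] (nth (domain_at c q t) [1] 2).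

Section Stages.
Variables (C : cantor) (c : nat).
Hypothesis Hc : forall x, C x = true <-> exists y, phi empty c x y.

(** An answer below 2 means that either [q] is already in the [t]-th stage, hence in all later ones,
    or [q] is outside [C], hence in no stage. *)
Lemma stage_of_settled t s q :
  t <= s -> settled C c t q < 2 -> stage c s q = settled C c t q.
Proof.
intros Hts; unfold settled, stage, char; destruct (C q) eqn:E; cbn [nth].
- destruct (domain_at c q t) eqn:D; [|now destruct n; cbn; lia].
  now rewrite (domain_at_mono c q t s D Hts).
- intros _; destruct (domain_at c q s) eqn:D; [|now destruct n].
  apply domain_at_sound, Hc in D; congruence.
Qed.

Lemma settled_limit q :
  exists t0, forall t, t0 <= t -> settled C c t q = char C q.
Proof.
unfold settled, char; destruct (C q) eqn:E; [|now exists 0].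
apply Hc in E; destruct E as [y Hy]; apply domain_at_complete in Hy.
destruct Hy as [t0 H0]; exists t0; intros t Ht.
now rewrite (domain_at_mono c q t0 t H0 Ht).
Qed.

End Stages.

Lemma total_stage A c : total_in A (fun z => stage c (pfst z) (psnd z)).
Proof.
unfold stage; total; apply total_domain_at; total.
Qed.

Lemma total_settled X C c :
  total_in (join X C) (fun z => settled C c (pfst z) (psnd z)).
Proof.
unfold settled; total.
2: apply total_domain_at; total.
apply (total_comp _ (char C)); [|total].
apply total_join_r; apply (total_char _ (fun x => x)); total.
Qed.

(** The program finds [s0] by [Mu] and then simulates. It returns the value component of the last
    configuration even if the simulation has not halted, so it converges whenever program [n] halts
    on [n]. *)
Lemma exists_stage_prog c :
  exists p, forall e n s, domain_at n n s = 0 ->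
  exists s0, domain_at n n s0 = 0 /\
    eval empty p <<e, n>> (pfst (run (stage c s0) s0 (init e e))).
Proof.
destruct (total_domain_at empty (fun z => psnd (pfst z)) (fun z => psnd (pfst z))
  (fun z => psnd z)) as [d Hd]; [total..|].
destruct (total_run empty (stage c) psnd psnd
  (fun z => init (pfst (pfst z)) (pfst (pfst z)))) as [r Hr];
  [apply total_stage|unfold init, push; total..|].
exists (Comp (Comp Fst r) (Pair (Pair Fst Snd) (Mu d))); intros e n s Hs.
destruct (eval_Mu_total empty d _ <<e, n>> s Hd) as (s0 & H0 & D0).
  now autorewrite with pairn.
autorewrite with pairn in D0; exists s0; split; [exact D0|].
econstructor; [constructor; [apply eval_Pair_Fst_Snd|exact H0]|].
econstructor; [apply Hr|].
autorewrite with pairn.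
rewrite <- (pairn_eta (run _ _ _)) at 1; constructor.
Qed.

Theorem mainTheorem4 (X C : cantor) (hX : has_DNC_degree X) (hC : comp_enum C) :
  turing_le jump_empty (join X C) \/ has_DNC_degree_rel C X.
Proof.
destruct hX as (g & Hg & Dg), hC as [c Hc].
rewrite computes_total_in in Hg.
destruct (exists_stage_prog c) as [p Hp].
pose (h e n := encode (Comp p (numeral <<e, n>>))).
assert (Th : forall A, total_in A (fun z => h (pfst z) (psnd z))).
  intros A; apply (total_comp _ (fun z => encode (Comp p (numeral z)))).
    apply total_encode_numeral.
  total.
(* Diagonal noncomputability of [g] is applied at the index [h e n], whose program converges on
   every input once [n] is in the halting set. *)
assert (Dh : forall e n s, domain_at n n s = 0 -> exists s0,
    domain_at n n s0 = 0 /\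
    g (h e n) <> pfst (run (stage c s0) s0 (init e e))).
  intros e n s Hs; destruct (Hp e n s Hs) as (s0 & H0 & E0).
  exists s0; split; [exact H0|apply Dg].
  unfold phi, h; rewrite decodeK; econstructor; [apply eval_numeral|exact E0].
destruct (classic (exists n, dnc_rel C (fun e => g (h e n)))) as [[n Hn]|Hno].
  right; exists (fun e => g (h e n)); split; [|exact Hn].
  apply computes_total_in, (total_comp _ g); [exact Hg|].
  apply (total_comp2 _ h); [apply Th|total..].
left.
pose (halt z := run (settled C c (psnd (psnd z))) (psnd (psnd z))
  (init (pfst (psnd z)) (pfst (psnd z)))).
pose (gh z := g (h (pfst (psnd z)) (pfst z))).
(* With z = [<<n, <<e, t>>>>], [f z] vanishes exactly when the run has halted with output
   [g (h e n)]; the two truncated differences add up to the distance. *)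
pose (f z := psnd (halt z) + ((pfst (halt z) - gh z) + (gh z - pfst (halt z)))).
assert (Tf : total_in (join X C) f).
  assert (total_in (join X C) halt).
    apply (total_run _ (settled C c) (fun z => psnd (psnd z)));
      [apply total_settled|unfold init, push; total..].
  assert (total_in (join X C) gh).
    apply (total_comp _ g); [now apply total_join_l|].
    apply (total_comp2 _ h); [apply Th|total..].
  unfold f; total; assumption.
destruct (total_search _ f Tf) as (w & Tw & Hw).
  (* If the search failed for [n], then [g (h e n)] as a function of [e] would be diagonally
     noncomputable relative to [C]. *)
  intros n; apply NNPP; intros Hf; apply Hno; exists n; intros e y Hy E; apply Hf.
  destruct (run_init_complete C (settled C c) e e y) as [t Ht].
      now apply settled_limit.
    exact Hy.
  exists <<e, t>>; unfold f, halt, gh; autorewrite with pairn.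
  rewrite Ht, E; autorewrite with pairn; lia.
apply computes_total_in.
(* The stage found for [n] bounds its halting time, so membership in the halting set is decided by
   running that long. *)
apply (total_ext _ (fun n => nth (domain_at n n (psnd (w n))) [1] 0)); cycle 1.
  total; apply total_domain_at; total; assumption.
intros n; specialize (Hw n); unfold f, halt, gh in Hw.
autorewrite with pairn in Hw.
set (t := psnd (w n)) in *; set (e := pfst (w n)) in *.
set (r := run _ _ _) in Hw.
assert (Hr : psnd r = 0 /\ pfst r = g (h e n)) by lia; destruct Hr as [R1 R2].
unfold char, jump_empty.
destruct excluded_middle_informative as [[y Hy]|Hn].
- destruct (domain_at n n t) eqn:D; [reflexivity|exfalso].
  apply domain_at_complete in Hy; destruct Hy as [s Hs].
  destruct (Dh e n s Hs) as (s0 & H0 & N0); apply N0.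
  assert (Hts : t <= s0).
    destruct (Nat.le_gt_cases t s0) as [|Hlt]; [assumption|].
    rewrite (domain_at_mono n n s0 t) in D; [discriminate|exact H0|lia].
  (* The run with the later stage [s0] ends in the same configuration as [r], so its output is
     [g (h e n)], against [N0]. *)
  rewrite <- R2; unfold r; f_equal.
  rewrite run_halted with (k := t) (j := s0); try assumption.
    symmetry; apply run_oracle_mono; [|exact R1].
    now intros q; apply stage_of_settled.
  rewrite run_oracle_mono with (o := settled C c t); [exact R1| |exact R1].
  now intros q; apply stage_of_settled.
- destruct (domain_at n n t) eqn:D; [|now destruct n0].
  apply domain_at_sound in D; contradiction.
Qed.
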